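(* Let $K$ be any field and let $T^*_K$ be any one of $T_K$, $T_K^s$, $T_K^a$. Every e.c. model of $T^*_K$ is $\omega$-saturated. If $K$ is at most countable then $T^*_K$ is $\omega$-categorical.
   Context: A $K$-bilinear space is a $K$-vector space $V$ with a map $[\cdot,\cdot]:V\times V\to K$ linear in each argument; it is symmetric if $[x,y]=[y,x]$ for all $x,y$, and alternating if $[x,x]=0$ for all $x$. Positive logic: a (positive existential) formula is built from atomic formulas using $\wedge,\vee,\top,\bot,\exists$. An h-inductive sentence has the form $\forall\bar x(\varphi(\bar x)\to\psi(\bar x))$ with $\varphi,\psi$ such formulas; a (positive) theory is a set of h-inductive sentences. A homomorphism is a function between structures preserving truth of formulas; it is an immersion if it also reflects truth of formulas. A model $M$ of $T$ is existentially closed (e.c.) if every homomorphism $f:M\to N$ with $N\models T$ is an immersion. $\mathcal L_K$ is the standard signature of $K$-vector spaces, with a unary function symbol for multiplication by each $\lambda\in K$, a relation symbol $\neq$ for inequality, and for every $\lambda\in K$ a binary relation symbol written $[x,y]=\lambda$, expressing that the bilinear product of $x$ and $y$ is $\lambda$. Every $K$-bilinear space is naturally viewed as an $\mathcal L_K$-structure. $T_K$, $T_K^s$, $T_K^a$ are the sets of all h-inductive $\mathcal L_K$-sentences true in all $K$-bilinear spaces, all symmetric $K$-bilinear spaces, and all alternating $K$-bilinear spaces, respectively. An e.c. model $M$ is $\omega$-saturated if every set of formulas in finitely many variables and with finitely many parameters from $M$ that is finitely satisfiable in $M$ is realised in $M$. A theory is $\omega$-categorical if it has exactly one countable e.c.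 model up to isomorphism. *)

(* Defs.v *)
From HB Require Import structures.
From mathcomp Require Import all_boot all_algebra.
From mathcomp Require Import sesquilinear.
From mathcomp Require Import boolp classical_sets cardinality.

Set Implicit Arguments.
Unset Strict Implicit.
Unset Printing Implicit Defensive.

Import GRing.Theory.
Local Open Scope classical_set_scope.
Local Open Scope ring_scope.

Record signature := Signature {
  fun_sym : Type;
  rel_sym : Type;
  fun_arity : fun_sym -> nat;
  rel_arity : rel_sym -> nat }.

Record structure (L : signature) := Structure {
  carrier :> Type;
  fun_interp : forall f : fun_sym L, ('I_(fun_arity f) -> carrier) -> carrier;
  rel_interp : forall r : rel_sym L, ('I_(rel_arity r) -> carrier) -> Prop }.

(* The index n is the number of variables in scope. *)
Inductive term (L : signature) (n : nat) : Type :=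
| Var (i : 'I_n)
| App (f : fun_sym L) (args : 'I_(fun_arity f) -> term L n).

Inductive formula (L : signature) : nat -> Type :=
| FTop n : formula L n
| FBot n : formula L n
| FEq n (s t : term L n) : formula L n
| FRel n (r : rel_sym L) (args : 'I_(rel_arity r) -> term L n) : formula L n
| FAnd n (p q : formula L n) : formula L n
| FOr n (p q : formula L n) : formula L n
| FEx n (p : formula L n.+1) : formula L n.

Fixpoint eval (L : signature) (M : structure L) n (v : 'I_n -> M)
    (t : term L n) : M :=
  match t with
  | Var i => v i
  | App f args => fun_interp (fun i => eval v (args i))
  end.

(* The variable bound by FEx is ord0; the variable i of the context becomes
   lift ord0 i under the binder. *)
Definition vcons (X : Type) n (x : X) (v : 'I_n -> X) : 'I_n.+1 -> X :=
  fun i => oapp v x (unlift ord0 i).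

Definition vcat (X : Type) n m (v : 'I_n -> X) (w : 'I_m -> X) :
    'I_(n + m) -> X :=
  fun i => match split i with inl j => v j | inr k => w k end.

Fixpoint sat (L : signature) (M : structure L) n (p : formula L n) :
    ('I_n -> M) -> Prop :=
  match p with
  | FTop _ => fun _ => True
  | FBot _ => fun _ => False
  | FEq _ s t => fun v => eval v s = eval v t
  | FRel _ r args => fun v => rel_interp (fun i => eval v (args i))
  | FAnd _ p q => fun v => sat p v /\ sat q v
  | FOr _ p q => fun v => sat p v \/ sat q v
  | FEx _ p => fun v => exists x : M, sat p (vcons x v)
  end.

Record hsentence (L : signature) := HSentence {
  hvars : nat;
  hyp : formula L hvars;
  concl : formula L hvars }.

Definition hsat (L : signature) (M : structure L) (s : hsentence L) : Prop :=
  forall v : 'I_(hvars s) -> M, sat (hyp s) v -> sat (concl s) v.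

Definition theory (L : signature) := set (hsentence L).

Definition is_model (L : signature) (T : theory L) (M : structure L) : Prop :=
  forall s, T s -> hsat M s.

Definition homomorphism (L : signature) (M N : structure L) (f : M -> N) :
    Prop :=
  forall n (p : formula L n) (v : 'I_n -> M), sat p v -> sat p (f \o v).

Definition immersion (L : signature) (M N : structure L) (f : M -> N) : Prop :=
  homomorphism f /\
  forall n (p : formula L n) (v : 'I_n -> M), sat p (f \o v) -> sat p v.

Definition ec_model (L : signature) (T : theory L) (M : structure L) : Prop :=
  is_model T M /\
  forall (N : structure L) (f : M -> N),
    is_model T N -> homomorphism f -> immersion f.

(* The first n variables of a formula in S are the unknowns, the last m are
   interpreted by the parameters a. *)
Definition omega_saturated (L : signature) (M : structure L) : Prop :=
  forall n m (a : 'I_m -> M) (S : set (formula L (n + m))),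
    (forall F : set (formula L (n + m)), finite_set F -> F `<=` S ->
       exists x : 'I_n -> M, forall p, F p -> sat p (vcat x a)) ->
    exists x : 'I_n -> M, forall p, S p -> sat p (vcat x a).

Definition isomorphic (L : signature) (M N : structure L) : Prop :=
  exists (f : M -> N) (g : N -> M),
    [/\ homomorphism f, homomorphism g, cancel f g & cancel g f].

Definition countable_ec_model (L : signature) (T : theory L)
    (M : structure L) : Prop :=
  ec_model T M /\ countable [set: M].

Definition omega_categorical (L : signature) (T : theory L) : Prop :=
  exists M : structure L, countable_ec_model T M /\
    forall N : structure L, countable_ec_model T N -> isomorphic M N.

Inductive LK_fun (K : Type) := FZero | FAdd | FOpp | FScale (c : K).

Definition LK_fun_arity (K : Type) (f : LK_fun K) : nat :=
  match f with FZero => 0 | FAdd => 2 | FOpp => 1 | FScale _ => 1 end.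

Inductive LK_rel (K : Type) := RNeq | RForm (c : K).

Definition LK (K : fieldType) : signature :=
  @Signature (LK_fun K) (LK_rel K) (@LK_fun_arity K) (fun=> 2).

Definition LK_fun_interp (K : fieldType) (V : lmodType K) (f : LK_fun K) :
    ('I_(LK_fun_arity f) -> V) -> V :=
  match f with
  | FZero => fun _ => 0
  | FAdd => fun v => v ord0 + v ord_max
  | FOpp => fun v => - v ord0
  | FScale c => fun v => c *: v ord0
  end.

Definition LK_rel_interp (K : fieldType) (V : lmodType K)
    (b : {biscalar V}) (r : LK_rel K) (v : 'I_2 -> V) : Prop :=
  match r with
  | RNeq => v ord0 <> v ord_max
  | RForm c => b (v ord0) (v ord_max) = c
  end.

Definition bilinear_structure (K : fieldType) (V : lmodType K)
    (b : {biscalar V}) : structure (LK K) :=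
  @Structure (LK K) V (@LK_fun_interp K V) (LK_rel_interp b).

Definition symmetric_form (K : fieldType) (V : lmodType K)
    (b : {biscalar V}) : Prop :=
  forall x y : V, b x y = b y x.

Definition alternating_form (K : fieldType) (V : lmodType K)
    (b : {biscalar V}) : Prop :=
  forall x : V, b x x = 0.

Definition TK (K : fieldType) : theory (LK K) :=
  [set s | forall (V : lmodType K) (b : {biscalar V}),
     hsat (bilinear_structure b) s].

Definition TKs (K : fieldType) : theory (LK K) :=
  [set s | forall (V : lmodType K) (b : {biscalar V}),
     symmetric_form b -> hsat (bilinear_structure b) s].

Definition TKa (K : fieldType) : theory (LK K) :=
  [set s | forall (V : lmodType K) (b : {biscalar V}),
     alternating_form b -> hsat (bilinear_structure b) s].

Arguments TK K : clear implicits.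
Arguments TKs K : clear implicits.
Arguments TKa K : clear implicits.

(* Main.v *)
Require Import Defs.
From HB Require Import structures.
From mathcomp Require Import all_boot all_algebra.
From mathcomp Require Import sesquilinear ring.
From mathcomp Require Import boolp classical_sets functions cardinality filter.

Set Implicit Arguments.
Unset Strict Implicit.
Unset Printing Implicit Defensive.

Import GRing.Theory.
Local Open Scope classical_set_scope.
Local Open Scope ring_scope.

(** Existentially closed models turn out to be exactly the generic bilinear
    spaces of the chosen kind: those in which every one-vector extension of a
    finite-dimensional subspace is already realised ([generic_form]).  The
    corollary then becomes a back-and-forth argument.

    A model need not be a bilinear space when K is infinite, because no
    h-inductive sentence says that every product [x, y] has a value.  But a
    model is a vector space with a partial product, any finite part of which
    fits into a total form of the right kind (otherwise a finite inconsistent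
    pattern would be refuted by a sentence of the theory), and by linear
    extension of functionals the whole partial product fits into one form.
    Hence every model maps identically into a bilinear space
    ([model_completion]), and an e.c. model is that space ([ec_model_space]).

    An e.c. space is generic ([ec_generic]).  Adjoin to it a vector y with
    prescribed products and a vector z with [a_i, z] = 0 and [y, z] = 1: the
    positive formula which describes y and z comes back to the space, and z
    certifies that y lies outside the span of the a_i, a fact which has no
    direct positive expression.

    In the converse direction, let W be any bilinear space of the same kind,
    taken modulo a subspace Z of its radical.  A finite-dimensional partial
    isometry from W / Z to a generic space extends to any further vector of W
    ([extend_partial_isometry]), so the positive formulas true in W / Z pass to
    the generic space by induction on formulas ([forced_sat]).  Three choices of
    W give everything.  For W a space which receives the generic space, one
    gets that generic spaces are e.c. ([generic_ec]).  For W an ultrapower,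
    made K-valued by composing its product with a K-linear retraction of the
    ultrapower of K onto K, one gets saturation ([generic_saturated]).  For W
    another generic space, the extension step alone, used in both directions,
    gives an isomorphism between countable generic spaces ([back_and_forth]).
    Finally, for countable K, a product on the polynomials whose Gram matrix on
    the monomials repeats every finite pattern of entries is generic
    ([countable_generic]). *)

(** * Linear functionals and subspaces *)

Definition subspace (K : fieldType) (V : lmodType K) (D : set V) : Prop :=
  D 0 /\ forall a x y, D x -> D y -> D (a *: x + y).

Section Subspace.
Variables (K : fieldType) (V : lmodType K) (D : set V).
Hypothesis subD : subspace D.

Lemma subspace0 : D 0. Proof. by case: subD. Qed.

Lemma subspaceP a x y : D x -> D y -> D (a *: x + y).
Proof. by case: subD => _; apply. Qed.

Lemma subspaceD x y : D x -> D y -> D (x + y).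
Proof. by move=> ? ?; rewrite -[x]scale1r; apply: subspaceP. Qed.

Lemma subspaceZ a x : D x -> D (a *: x).
Proof. by move=> ?; rewrite -[_ *: _]addr0; apply: subspaceP => //; exact: subspace0. Qed.

Lemma subspaceN x : D x -> D (- x).
Proof. by rewrite -scaleN1r; exact: subspaceZ. Qed.

Lemma subspaceB x y : D x -> D y -> D (x - y).
Proof. by move=> ? ?; apply: subspaceD => //; apply: subspaceN. Qed.

Lemma subspace_sum (I : eqType) (r : seq I) (F : I -> V) :
  (forall i, i \in r -> D (F i)) -> D (\sum_(i <- r) F i).
Proof.
move=> DF; rewrite big_seq; elim/big_rec: _ => [|i x ri]; first exact: subspace0.
exact/subspaceD/DF.
Qed.

End Subspace.

Lemma subspace_adjoin (K : fieldType) (V : lmodType K) (D : set V) (v : V) :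
  subspace D -> subspace [set x | exists2 y, D y & exists c, x = y + c *: v].
Proof.
move=> sD; split; first by exists 0; [exact: subspace0 | exists 0; rewrite scale0r addr0].
move=> a _ _ [x Dx [c ->]] [y Dy [d ->]].
exists (a *: x + y); first exact: subspaceP.
exists (a * c + d); by rewrite scalerDr scalerDl scalerA addrACA.
Qed.

Lemma scalar_of (K : fieldType) (V : lmodType K) (f : V -> K) :
  (forall a x y, f (a *: x + y) = a * f x + f y) ->
  exists f' : {scalar V}, f' = f :> (V -> K).
Proof.
move=> fL; pose fM := GRing.isLinear.Build K V K *%R f fL.
by pose f' : {scalar V} := HB.pack f fM; exists f'.
Qed.

(** A partial functional is given by its graph, so that a maximal extension is a
    maximal set and Zorn's lemma applies to sets ordered by inclusion; being
    single-valued reduces to the fibre over 0. *)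
Lemma linear_extension (K : fieldType) (V : lmodType K) (G : set (V * K^o)) :
  subspace G -> (forall k, G (0, k) -> k = 0) ->
  exists phi : {scalar V}, forall v k, G (v, k) -> phi v = k.
Proof.
move=> sG G0.
pose good (H : set (V * K^o)) := subspace H /\ forall k, H (0, k) -> k = 0.
have [A [gA maxA]] : exists A, good (G `|` A) /\
    forall B, A `<` B -> ~ good (G `|` B).
  apply: Zorn_bigcup => F goodF totF.
  (* two members of the union always lie in a common good set *)
  have common x y : (G `|` \bigcup_(X in F) X) x -> (G `|` \bigcup_(X in F) X) y ->
      exists H, [/\ good H, H x, H y & H `<=` G `|` \bigcup_(X in F) X].
    have inF X : F X -> G `|` X `<=` G `|` \bigcup_(X in F) X.
      by move=> FX z [Gz|Xz]; [left | right; exists X].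
    case=> [Gx|[X FX Xx]] [Gy|[Y FY Yy]].
    - by exists G; split=> // z; left.
    - by exists (G `|` Y); split; [exact: goodF|left|right|exact: inF].
    - by exists (G `|` X); split; [exact: goodF|right|left|exact: inF].
    - case: (totF X Y FX FY) => [XY|YX].
      + by exists (G `|` Y); split; [exact: goodF|right; exact: XY|right|exact: inF].
      + by exists (G `|` X); split; [exact: goodF|right|right; exact: YX|exact: inF].
  split; last first.
    by move=> k Hk; have [H [[_ H0] Hx _ _]] := common _ _ Hk Hk; exact: H0.
  split; first by left; exact: subspace0.
  move=> a x y Hx Hy; have [H [[sH _] {}Hx {}Hy HU]] := common _ _ Hx Hy.
  by apply: HU; exact: subspaceP.
case: gA; set H := G `|` A => sH H0.
have total v : exists k, H (v, k).
  apply: contrapT => /forallNP vN.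
  (* the maximal graph, extended by the value 0 at v *)
  pose B := [set x | exists2 y, H y & exists c : K, x = y + c *: ((v, 0) : V * K^o)].
  have HB : H `<=` B by move=> y Hy; exists y => //; exists 0; rewrite scale0r addr0.
  have GB : G `|` B = B by apply/setUidPr => z Gz; apply: HB; left.
  apply: (maxA B); first split.
  - by move=> z Az; apply: HB; right.
  - move=> BA; apply: (vN 0); right; apply: BA; exists 0; first exact: subspace0.
    by exists 1; rewrite scale1r add0r.
  - rewrite GB; split; first exact: subspace_adjoin.
    move=> k [[y l] Hy [c [e ->]]]; rewrite scaler0 addr0.
    have [c0|cN0] := eqVneq c 0.
      by move: e; rewrite c0 scale0r addr0 => e; apply: H0; rewrite e.
    case: (vN (- c^-1 *: l)).
    suff -> : v = - c^-1 *: y by exact: (subspaceZ sH (- c^-1) Hy).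
    have -> : y = - (c *: v) by apply/eqP; rewrite -addr_eq0 -e.
    by rewrite scaleNr scalerN opprK scalerA mulVf // scale1r.
have [phi phiP] := choice total.
have phiE v k : H (v, k) -> phi v = k.
  move=> Hk; apply/eqP; rewrite -subr_eq0; apply/eqP; apply: H0.
  by have := subspaceB sH (phiP v) Hk; rewrite /= -[X in H X]/(v - v, phi v - k) subrr.
have phiL a x y : phi (a *: x + y) = a * phi x + phi y.
  apply: phiE; exact: (subspaceP sH a (phiP x) (phiP y)).
have [phi' phi'E] := scalar_of phiL.
by exists phi' => v k Gv; rewrite phi'E; apply: phiE; left.
Qed.

(** * Kinds of forms and completion of partial products *)

Variant form_kind := General | Symmetric | Alternating.

Section Kinds.
Variables (K : fieldType) (k : form_kind).

Definition of_kind (V : Type) (b : V -> V -> K) : Prop :=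
  match k with
  | General => True
  | Symmetric => forall x y, b x y = b y x
  | Alternating => forall x, b x x = 0
  end.

(** The relation between [x, y] and [y, x] which a form of the given kind
    imposes. *)
Definition transpose_values (l r : K) : Prop :=
  match k with
  | General => True
  | Symmetric => r = l
  | Alternating => r = - l
  end.

Definition diagonal_value (c : K) : Prop :=
  if k is Alternating then c = 0 else True.

Definition kind_theory : theory (LK K) :=
  [set s | forall (V : lmodType K) (b : {biscalar V}),
     of_kind b -> hsat (bilinear_structure b) s].

Lemma symmetric_kind (V : Type) (b : V -> V -> K) :
  k = Symmetric -> of_kind b -> forall x y, b x y = b y x.
Proof. by rewrite /of_kind => ->. Qed.

Lemma alternating_kind (V : Type) (b : V -> V -> K) :
  k = Alternating -> of_kind b -> forall x, b x x = 0.
Proof. by rewrite /of_kind => ->. Qed.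

Lemma of_kind_transpose (V : lmodType K) (b : {biscalar V}) x y :
  of_kind b -> transpose_values (b x y) (b y x).
Proof.
rewrite /of_kind /transpose_values; case: k => // bk.
have := bk (x + y); rewrite linearDl !linearDr !bk add0r addr0 => /eqP.
by rewrite addrC addr_eq0 => /eqP.
Qed.

Lemma of_kind_diagonal (V : lmodType K) (b : {biscalar V}) x :
  of_kind b -> diagonal_value (b x x).
Proof. by rewrite /of_kind /diagonal_value; case: k. Qed.

End Kinds.

Lemma biscalar_of (K : fieldType) (V : lmodType K) (b : V -> V -> K) :
  (forall a x y z, b (a *: x + y) z = a * b x z + b y z) ->
  (forall a x y z, b z (a *: x + y) = a * b z x + b z y) ->
  exists b' : {biscalar V}, b' = b :> (V -> V -> K).
Proof.
move=> bl br.
pose bM := bilinear_isBilinear.Build K V V K *%R *%R b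
  ((fun z a x y => bl a x y z), (fun z a x y => br a x y z)).
pose b' : {biscalar V} := HB.pack b bM.
by exists b'.
Qed.

(** The products x, y |-> [x, y] are turned into vectors: x and y determine the
    evaluation of forms of kind [k] at (x, y), a function on the set of all such
    forms, and these evaluations depend bilinearly on x and y.  A partial product
    is then a partial functional on evaluations, well defined as soon as every
    finite part of it is fitted by some form; its linear extension, read back on
    evaluations, is again bilinear and of kind [k].  This replaces the tensor
    product and its symmetric or exterior quotients. *)
Lemma form_extension (K : fieldType) (k : form_kind) (V : lmodType K)
    (R : set (V * V * K)) :
  (forall s : seq (V * V * K), (forall t, t \in s -> R t) ->
     exists b : {biscalar V}, of_kind k b /\
       forall t, t \in s -> b t.1.1 t.1.2 = t.2) ->
  exists b : {biscalar V}, of_kind k b /\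
    forall x y c, R (x, y, c) -> b x y = c.
Proof.
move=> fitR.
pose F := {b : {biscalar V} | of_kind k b}.
pose ev x y : F -> K^o := fun b => sval b x y.
pose gen (t : K * (V * V * K)) : (F -> K^o) * K^o :=
  t.1 *: ((ev t.2.1.1 t.2.1.2, t.2.2) : (F -> K^o) * K^o).
pose G := [set p | exists2 s : seq (K * (V * V * K)),
  forall t, t \in s -> R t.2 & p = \sum_(t <- s) gen t].
have sG : subspace G.
  split; first by exists [::]; rewrite ?big_nil.
  move=> a _ _ [s sR ->] [s' sR' ->].
  exists ([seq (a * t.1, t.2) | t <- s] ++ s').
    by move=> t; rewrite mem_cat => /orP[/mapP[u /sR Ru ->]|/sR'].
  rewrite big_cat big_map scaler_sumr; congr (_ + _).
  by apply: eq_bigr => t _; rewrite /gen scalerA.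
have G0 c : G (0, c) -> c = 0.
  case=> s sR sE.
  have [|b [bk bs]] := fitR [seq t.2 | t <- s].
    by move=> t /mapP[u /sR Ru ->].
  pose D : set ((F -> K^o) * K^o) := [set p | p.1 (exist _ b bk) = p.2].
  have sD : subspace D
    by split=> // a [w l] [w' l'] /=; rewrite /D /= => <- <-.
  suff : D (0, c) by [].
  rewrite sE; apply: (subspace_sum sD) => t ts; apply: (subspaceZ sD).
  by apply: bs; apply: map_f.
have [phi phiG] := linear_extension sG G0.
pose b x y := phi (ev x y).
have evl a x y z : ev (a *: x + y) z = a *: ev x z + ev y z.
  by apply: funext => f; rewrite /ev linearPl.
have evr a x y z : ev z (a *: x + y) = a *: ev z x + ev z y.
  by apply: funext => f; rewrite /ev linearPr.
have [||b' b'E] := @biscalar_of K V b.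
- by move=> *; rewrite /b evl linearP.
- by move=> *; rewrite /b evr linearP.
exists b'; rewrite b'E; split; last first.
  move=> x y c Rc; apply: phiG; exists [:: (1, (x, y, c))].
    by move=> t; rewrite inE => /eqP ->.
  by rewrite big_seq1 /gen scale1r.
have kF (f : F) : of_kind k (sval f) by case: f.
rewrite /b {1}/of_kind; case kE: k => //.
- move=> x y; congr (phi _); apply: funext => f; exact: (symmetric_kind kE (kF f)).
- move=> x; rewrite (_ : ev x x = 0) ?linear0 //; apply: funext => f.
  exact: (alternating_kind kE (kF f)).
Qed.

(** * Generic forms and partial isometries *)

(** [D] is only included in the span of finitely many vectors, which makes the
    notion hereditary and spares the choice of generators inside [D]. *)
Definition fin_span (K : fieldType) (V : lmodType K) (D : set V) : Prop :=
  exists n (a : 'I_n -> V), forall x, D x ->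
    exists c : 'I_n -> K, x = \sum_i c i *: a i.

Lemma fin_span_adjoin (K : fieldType) (V : lmodType K) (D E : set V) (v : V) :
  fin_span D -> (forall x, E x -> exists2 y, D y & exists c, x = y + c *: v) ->
  fin_span E.
Proof.
move=> [n [a aD]] ED; exists n.+1, (vcons v a) => x /ED[y /aD[c ->] [d ->]].
exists (vcons d c); rewrite big_ord_recl addrC /vcons unlift_none /=.
by congr (_ + _); apply: eq_bigr => i _; rewrite liftK.
Qed.

Lemma fin_span_sub (K : fieldType) (V : lmodType K) (D E : set V) :
  fin_span D -> E `<=` D -> fin_span E.
Proof. by move=> [n [a aD]] ED; exists n, a => x /ED /aD. Qed.

(** The functionals are global, so that the compatibility with the kind is a
    pointwise condition and the data defines a one-vector extension of the whole
    space. *)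
Definition generic_form (K : fieldType) (k : form_kind) (V : lmodType K)
    (b : {biscalar V}) : Prop :=
  forall (D : set V) (phi psi : {scalar V}) (nu : K),
    fin_span D -> (forall x, transpose_values k (phi x) (psi x)) ->
    diagonal_value k nu ->
    exists y, [/\ forall x, D x -> b x y = phi x,
                  forall x, D x -> b y x = psi x, b y y = nu & ~ D y].

Section PartialIsometry.
Variables (K : fieldType) (k : form_kind) (W V : lmodType K).
Variables (beta : {biscalar W}) (b : {biscalar V}) (Z : set W).

(** [Gamma] is the graph of an isometry from a subspace of W / Z to [V], pulled
    back to [W]; working with [W] and [Z] avoids forming the quotient space. *)
Definition partial_isometry (Gamma : set (W * V)) : Prop :=
  [/\ subspace Gamma, forall z, Z z -> Gamma (z, 0),
      forall w v, Gamma (w, v) -> (Z w <-> v = 0) &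
      forall w v w' v', Gamma (w, v) -> Gamma (w', v') -> beta w w' = b v v'].

Hypotheses (betak : of_kind k beta) (bgen : generic_form k b).
Hypotheses (radl : forall z w, Z z -> beta z w = 0)
           (radr : forall z w, Z z -> beta w z = 0).

(** If [h] is outside the domain, the products of [h] with the domain are
    transported to functionals on the range, and genericity gives a vector [y]
    outside the range with these products.  Both being outside, the extended
    graph stays single-valued in both directions. *)
Lemma extend_partial_isometry (Gamma : set (W * V)) (h : W) :
  partial_isometry Gamma -> fin_span (snd @` Gamma) ->
  exists y (Gamma' : set (W * V)),
    [/\ partial_isometry Gamma', Gamma `<=` Gamma', Gamma' (h, y) &
        forall p, Gamma' p -> exists2 q, Gamma q & exists c, p = q + c *: (h, y)].
Proof.
move=> isoG finG; case: (isoG) => sG GZ GK Gb.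
have [[v Gv]|hN] := pselect (exists v, Gamma (h, v)).
  exists v, Gamma; split=> // p Gp; exists p => //.
  by exists 0; rewrite scale0r addr0.
have [phi phiE] : exists phi : {scalar V},
    forall w v, Gamma (w, v) -> phi v = beta w h.
  pose H := [set p : V * K^o | exists2 w, Gamma (w, p.1) & p.2 = beta w h].
  have [||phi phiE] := @linear_extension K V H.
  - split; first by exists 0; [exact: (subspace0 sG) | rewrite linear0l].
    move=> a [v c] [v' c'] [w /= Gw ->] [w' /= Gw' ->]; exists (a *: w + w').
      exact: (subspaceP sG a Gw Gw').
    by rewrite linearPl.
  - by move=> c [w /= Gw ->]; apply: radl; apply/(GK _ _ Gw).
  - by exists phi => w v Gwv; apply: phiE; exists w.
have [psi [psiE psik]] : exists psi : {scalar V},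
    (forall w v, Gamma (w, v) -> psi v = beta h w) /\
    forall x, transpose_values k (phi x) (psi x).
  rewrite /transpose_values; case kE: k.
  - pose H := [set p : V * K^o | exists2 w, Gamma (w, p.1) & p.2 = beta h w].
    have [||psi psiE] := @linear_extension K V H.
    + split; first by exists 0; [exact: (subspace0 sG) | rewrite linear0r].
      move=> a [v c] [v' c'] [w /= Gw ->] [w' /= Gw' ->]; exists (a *: w + w').
        exact: (subspaceP sG a Gw Gw').
      by rewrite linearPr.
    + by move=> c [w /= Gw ->]; apply: radr; apply/(GK _ _ Gw).
    + by exists psi; split=> // w v Gwv; apply: psiE; exists w.
  - exists phi; split=> // w v /phiE ->; exact: symmetric_kind kE betak _ _.
  - exists (\- phi : {scalar V}); split=> // w v /phiE /= ->.
    by have := of_kind_transpose h w betak; rewrite /transpose_values kE => ->;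
      rewrite opprK.
have [y [by1 by2 by3 Gy]] := bgen finG psik (of_kind_diagonal h betak).
exists y, [set x | exists2 p, Gamma p & exists c, x = p + c *: (h, y)].
have shift w v c : (w, v) + c *: (h, y) = (w + c *: h, v + c *: y) by [].
split=> //.
- split; first exact: subspace_adjoin.
  + by move=> z Zz; exists (z, 0); [exact: GZ | exists 0; rewrite scale0r addr0].
  + move=> _ _ [[w v] Gwv [c [-> ->]]] /=; split.
    * have [->|c0] := eqVneq c 0; first by rewrite !scale0r !addr0 => /(GK _ _ Gwv).
      move=> Zwh; case: hN; exists (- (c^-1 *: v)).
      suff -> : (h, - (c^-1 *: v)) = c^-1 *: ((w + c *: h, 0) - (w, v)).
        by apply: (subspaceZ sG); apply: (subspaceB sG) => //; exact: GZ.
      apply/pair_equal_spec; split => /=; last by rewrite sub0r scalerN.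
      by rewrite addrAC subrr add0r scalerA mulVf // scale1r.
    * have [->|c0] := eqVneq c 0; first by rewrite !scale0r !addr0 => /(GK _ _ Gwv).
      move=> /eqP; rewrite addrC addr_eq0 => /eqP cy; case: Gy.
      exists (c^-1 *: (- (w, v))); first exact/(subspaceZ sG)/(subspaceN sG).
      by rewrite /= -cy scalerA mulVf // scale1r.
  + move=> _ _ _ _ [[w v] Gp [c [-> ->]]] [[w' v'] Gp' [c' [-> ->]]] /=.
    have rG p : Gamma p -> (snd @` Gamma) p.2 by exists p.
    rewrite !linearDl !linearDr !linearZl_LR !linearZr_LR /=.
    rewrite (Gb _ _ _ _ Gp Gp') (by1 _ (rG _ Gp)) (by2 _ (rG _ Gp')) by3.
    by rewrite (phiE _ _ Gp) (psiE _ _ Gp').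
- by move=> p Gp; exists p => //; exists 0; rewrite scale0r addr0.
- by exists 0; [exact: subspace0 | exists 1; rewrite scale1r add0r].
Qed.

Lemma extend_partial_isometry_seq (Gamma : set (W * V)) (hs : seq W) :
  partial_isometry Gamma -> fin_span (snd @` Gamma) ->
  exists Gamma' : set (W * V),
    [/\ partial_isometry Gamma', fin_span (snd @` Gamma'), Gamma `<=` Gamma' &
        forall h, h \in hs -> exists y, Gamma' (h, y)].
Proof.
move=> isoG finG; elim: hs => [|h hs [G1 [iso1 fin1 GG1 G1h]]].
  by exists Gamma; split.
have [y [G2 [iso2 G12 G2h G2fin]]] := extend_partial_isometry h iso1 fin1.
exists G2; split=> //.
- apply: (fin_span_adjoin (v := y) fin1) => _ [p /G2fin[q Gq [c ->]] <-].
  by exists q.2; [exists q | exists c].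
- exact: subset_trans G12.
- move=> h'; rewrite inE => /orP[/eqP ->|/G1h[z G1z]]; first by exists y.
  by exists z; apply: G12.
Qed.

End PartialIsometry.

(** * Transfer of positive formulas *)

Lemma eval_subspace (K : fieldType) (W V : lmodType K) (beta : {biscalar W})
    (b : {biscalar V}) (Gamma : set (W * V)) n (f : 'I_n -> W) (g : 'I_n -> V)
    (t : term (LK K) n) :
  subspace Gamma -> (forall i, Gamma (f i, g i)) ->
  Gamma (eval (M := bilinear_structure beta) f t,
         eval (M := bilinear_structure b) g t).
Proof.
move=> sG Gfg; elim: t => [i|[|||c] args IH] /=; first exact: Gfg.
- exact: (subspace0 sG).
- exact: (subspaceD sG (IH ord0) (IH ord_max)).
- exact: (subspaceN sG (IH ord0)).
- exact: (subspaceZ sG c (IH ord0)).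
Qed.

(** The half of the truth definition which is needed to transfer positive
    formulas out of W / Z.  It holds for truth in [W] itself when Z = 0, and for
    truth almost everywhere along an ultrafilter. *)
Record forcing (K : fieldType) (W : lmodType K) (beta : {biscalar W})
    (Z : set W) (Q : forall n, formula (LK K) n -> ('I_n -> W) -> Prop) : Prop :=
  Forcing {
  forcing_bot : forall n (f : 'I_n -> W), ~ Q n (FBot (LK K) n) f;
  forcing_and : forall n (p q : formula (LK K) n) f,
    Q n (FAnd p q) f -> Q n p f /\ Q n q f;
  forcing_or : forall n (p q : formula (LK K) n) f,
    Q n (FOr p q) f -> Q n p f \/ Q n q f;
  forcing_ex : forall n (p : formula (LK K) n.+1) f,
    Q n (FEx p) f -> exists w, Q n.+1 p (vcons w f);
  forcing_eq : forall n (s t : term (LK K) n) f, Q n (FEq s t) f ->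
    Z (eval (M := bilinear_structure beta) f s -
       eval (M := bilinear_structure beta) f t);
  forcing_neq : forall n (args : 'I_2 -> term (LK K) n) f,
    Q n (@FRel (LK K) n (RNeq K) args) f ->
    ~ Z (eval (M := bilinear_structure beta) f (args ord0) -
         eval (M := bilinear_structure beta) f (args ord_max));
  forcing_form : forall n c (args : 'I_2 -> term (LK K) n) f,
    Q n (@FRel (LK K) n (RForm c) args) f ->
    beta (eval (M := bilinear_structure beta) f (args ord0))
         (eval (M := bilinear_structure beta) f (args ord_max)) = c }.

Section Forced.
Variables (K : fieldType) (k : form_kind) (W V : lmodType K).
Variables (beta : {biscalar W}) (b : {biscalar V}) (Z : set W).
Hypotheses (betak : of_kind k beta) (bgen : generic_form k b).
Hypotheses (radl : forall z w, Z z -> beta z w = 0)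
           (radr : forall z w, Z z -> beta w z = 0).
Variable Q : forall n, formula (LK K) n -> ('I_n -> W) -> Prop.
Hypothesis forcingQ : forcing beta Z Q.

(** By induction on the formula: atomic formulas are read through the partial
    isometry, and a witness of an existential quantifier is matched by extending
    it by one vector. *)
Lemma forced_sat n (p : formula (LK K) n) (f : 'I_n -> W) (g : 'I_n -> V)
    (Gamma : set (W * V)) :
  partial_isometry beta b Z Gamma -> fin_span (snd @` Gamma) ->
  (forall i, Gamma (f i, g i)) -> Q p f ->
  sat (M := bilinear_structure b) p g.
Proof.
case: forcingQ => Qbot Qand Qor Qex Qeq Qneq Qform.
elim: p f g Gamma => {n} [n|n|n s t|n r args|n p IHp q IHq|n p IHp q IHq|n p IHp]
    f g Gamma isoG finG Gfg /=.
- by [].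
- exact: Qbot.
- case: (isoG) => sG _ GK _ /Qeq Zst; apply/eqP; rewrite -subr_eq0; apply/eqP.
  have Gst := subspaceB sG
    (eval_subspace beta b s sG Gfg) (eval_subspace beta b t sG Gfg).
  exact: (GK _ _ Gst).1.
- case: (isoG) => sG _ GK Gb.
  have Garg i := eval_subspace beta b (args i) sG Gfg.
  case: r args Garg => [|c] args Garg /= Qr.
  + move=> e; apply: (Qneq _ _ _ Qr).
    by apply/(GK _ _ (subspaceB sG (Garg ord0) (Garg ord_max))); rewrite e subrr.
  + by rewrite -(Gb _ _ _ _ (Garg ord0) (Garg ord_max)); exact: Qform Qr.
- by case/Qand => Qp Qq; split; [exact: IHp Gfg Qp | exact: IHq Gfg Qq].
- by case/Qor => [Qp|Qq]; [left; exact: IHp Gfg Qp | right; exact: IHq Gfg Qq].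
- case/Qex => w Qp.
  have [y [G' [isoG' GG' G'wy G'fin]]] :=
    extend_partial_isometry betak bgen radl radr w isoG finG.
  exists y; apply: (IHp _ _ G') Qp => //.
    apply: (fin_span_adjoin (v := y) finG) => _ [x /G'fin[x' Gx' [c ->]] <-].
    by exists x'.2; [exists x' | exists c].
  by move=> i; rewrite /vcons; case: (unlift _ _) => [j|] //=; apply: GG'.
Qed.

End Forced.

Lemma sat_forcing (K : fieldType) (V : lmodType K) (b : {biscalar V}) :
  forcing b [set 0] (fun n p f => sat (M := bilinear_structure b) p f).
Proof.
split=> //=; first by move=> ? ? [].
- by move=> n s t f ->; rewrite subrr.
- by move=> n args f fN e; apply: fN; apply/eqP; rewrite -subr_eq0 e.
Qed.

(** * Ultrapowers and saturation *)

Lemma subspace_combinations (K : fieldType) (V : lmodType K) n (a : 'I_n -> V) :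
  subspace [set x | exists c : 'I_n -> K, x = \sum_i c i *: a i].
Proof.
split; first by exists (fun=> 0); rewrite big1 // => i _; rewrite scale0r.
move=> d _ _ [c ->] [c' ->]; exists (fun i => d * c i + c' i).
rewrite scaler_sumr -big_split; apply: eq_bigr => i _ /=.
by rewrite scalerA scalerDl.
Qed.

Lemma combinations_generator (K : fieldType) (V : lmodType K) n (a : 'I_n -> V) i :
  exists c : 'I_n -> K, a i = \sum_j c j *: a j.
Proof.
exists (fun j => (j == i)%:R); rewrite (bigD1 i) //= eqxx scale1r big1 ?addr0 //.
by move=> j /negPf ->; rewrite scale0r.
Qed.

Section Ultrapower.
Variables (K : fieldType) (k : form_kind) (V : lmodType K) (b : {biscalar V}).
Variables (I : Type) (U : set_system I) (UU : UltraFilter U).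
Hypotheses (bk : of_kind k b) (bgen : generic_form k b).

Local Notation satb := (sat (M := bilinear_structure b)).

(** A K-linear retraction of the ultrapower of K onto K: the limit along [U] is
    defined and linear on the functions which are almost everywhere constant, and
    extends linearly to all functions. *)
Lemma ultralimit_functional :
  exists pi : {scalar (I -> K^o)}, forall f c, U [set i | f i = c] -> pi f = c.
Proof.
pose G := [set p : (I -> K^o) * K^o | U [set i | p.1 i = p.2]].
have [||pi piE] := @linear_extension K _ G; last by exists pi.
- split; first by apply: filterE => i.
  move=> a [f c] [g d] /= fc gd; apply: filterS2 fc gd => i /= fi gi.
  by rewrite -fi -gi.
- by move=> c /filter_ex [i /= <-].
Qed.

Lemma eval_pointwise (beta : {biscalar (I -> V)}) n (f : 'I_n -> I -> V)
    (t : term (LK K) n) i :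
  eval (M := bilinear_structure beta) f t i =
  eval (M := bilinear_structure b) (fun j => f j i) t.
Proof.
by elim: t => [j|[|||c] args IH] //=; rewrite -!IH.
Qed.

(** Los's theorem for positive formulas, where only the almost constant values
    of the product are remembered. *)
Lemma ultrapower_forcing (beta : {biscalar (I -> V)}) :
  (forall f g c, U [set i | b (f i) (g i) = c] -> beta f g = c) ->
  forcing beta [set f | U [set i | f i = 0]]
    (fun n p f => U [set i | satb p (fun j => f j i)]).
Proof.
move=> betaE; split=> /=.
- by move=> n f /filter_ex [].
- by move=> n p q f Upq; split; apply: filterS Upq => i [].
- move=> n p q f Upq.
  have [Up|UNp] := in_ultra_setVsetC [set i | satb p (fun j => f j i)] UU.
    by left.
  by right; apply: filterS2 Upq UNp => i [].
- move=> n p f Up.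
  have /choice[w wE] i : exists y, (exists x : V, satb p (vcons x (fun j => f j i))) ->
      satb p (vcons y (fun j => f j i)).
    have [[x px]|pN] := pselect (exists x : V, satb p (vcons x (fun j => f j i))).
      by exists x.
    by exists 0.
  exists w; apply: filterS Up => i /wE.
  congr (sat _ _); apply: funext => j.
  by rewrite /vcons; case: (unlift _ _).
- move=> n s t f; apply: filterS => i /= e.
  by rewrite -[_ i]/(_ i - _ i) !eval_pointwise e subrr.
- move=> n args f fN f0; have [i [/= ne]] := filter_ex (filterI fN f0).
  rewrite -[_ i]/(_ i - _ i) !eval_pointwise => /eqP; rewrite subr_eq0 => /eqP.
  exact: ne.
- by move=> n c args f Uc; apply: betaE; apply: filterS Uc => i /=; rewrite !eval_pointwise.
Qed.

(** The constants form a copy of the span of the parameters in the ultrapower;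
    the partial isometry sending them back to [V] extends to the finitely many
    classes of [xs]. *)
Lemma ultrapower_realized n m (a : 'I_m -> V) (xs : 'I_n -> I -> V) :
  exists x : 'I_n -> V, forall p : formula (LK K) (n + m),
    U [set i | satb p (vcat (fun j => xs j i) a)] ->
    satb p (vcat x a).
Proof.
have [pi piE] := ultralimit_functional.
have [||beta betaE] := @biscalar_of K _ (fun f g : I -> V => pi (fun i => b (f i) (g i))).
- move=> c f g h; rewrite -linearP; congr (pi _).
  by apply: funext => i; rewrite linearPl.
- move=> c f g h; rewrite -linearP; congr (pi _).
  by apply: funext => i; rewrite linearPr.
pose Z := [set f : I -> V | U [set i | f i = 0]].
have betaU f g c : U [set i | b (f i) (g i) = c] -> beta f g = c.
  by rewrite betaE; apply: piE.
have betak : of_kind k beta.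
  rewrite betaE /of_kind; case kE: k => //.
  - by move=> f g; congr (pi _); apply: funext => i; exact: symmetric_kind kE bk _ _.
  - by move=> f; apply: piE; apply: filterE => i; exact: alternating_kind kE bk _.
have radl z w : Z z -> beta z w = 0.
  by move=> Zz; apply: betaU; apply: filterS Zz => i /= ->; rewrite linear0l.
have radr z w : Z z -> beta w z = 0.
  by move=> Zz; apply: betaU; apply: filterS Zz => i /= ->; rewrite linear0r.
pose span_a := [set x | exists c : 'I_m -> K, x = \sum_i c i *: a i].
pose Gamma := [set p : (I -> V) * V | span_a p.2 /\ U [set i | p.1 i = p.2]].
have sa : subspace span_a := subspace_combinations a.
have isoG : partial_isometry beta b Z Gamma.
  split.
  - split; first by split; [exact: (subspace0 sa) | apply: filterE].
    move=> c [w v] [w' v'] [/= sv wv] [/= sv' wv']; split.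
      exact: (subspaceP sa c sv sv').
    by apply: filterS2 wv wv' => i /= <- <-.
  - by move=> z Zz; split => //; exact: (subspace0 sa).
  - move=> w v [/= _ wv]; split=> [Zw|v0]; last by rewrite v0 in wv.
    by have [i [/= <- ->]] := filter_ex (filterI wv Zw).
  - move=> w v w' v' [/= _ wv] [/= _ wv']; apply: betaU.
    by apply: filterS2 wv wv' => i /= -> ->.
have finG : fin_span (snd @` Gamma) by exists m, a => _ [p [sp _] <-].
have [G' [isoG' finG' GG' G'xs]] :=
  extend_partial_isometry_seq betak bgen radl radr (codom xs) isoG finG.
have /choice[x xE] j : exists y, G' (xs j, y) by apply: G'xs; apply: codom_f.
exists x => p Up.
apply: (forced_sat betak bgen radl radr (ultrapower_forcing betaU)
  (f := vcat xs (fun j _ => a j)) isoG' finG').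
  move=> j; rewrite /vcat; case: (fintype.split j) => // j'.
  by apply: GG'; split; [exact: combinations_generator | apply: filterE].
apply: filterS Up => i; congr (sat _ _); apply: funext => j.
by rewrite /vcat; case: (fintype.split j).
Qed.

End Ultrapower.

(** Compactness: the ultrafilter lives on the finite parts of the type and
    contains, for each formula, the set of parts to which it belongs. *)
Lemma generic_saturated (K : fieldType) (k : form_kind) (V : lmodType K)
    (b : {biscalar V}) :
  of_kind k b -> generic_form k b -> omega_saturated (bilinear_structure b).
Proof.
move=> bk bgen n m a S finsat.
pose I := {F : set (formula (LK K) (n + m)) | finite_set F /\ F `<=` S}.
pose index F (FS : finite_set F /\ F `<=` S) : I := exist _ F FS.
have /choice[x xE] (F : I) : exists x : 'I_n -> V,
    forall p, sval F p -> sat (M := bilinear_structure b) p (vcat x a).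
  by case: F => F [finF FS]; exact: finsat.
pose above : set_system I :=
  [set A | exists F0 : I, forall F : I, sval F0 `<=` sval F -> A F].
have pr : ProperFilter above.
  apply: Build_ProperFilter_ex.
    by move=> A [F0 F0A]; exists F0; apply: F0A.
  split.
  - by exists (index set0 (conj (finite_set0 _) (sub0set S))).
  - move=> A B [[F [finF FS]] FA] [[G [finG GS]] GB].
    have FG : finite_set (F `|` G) /\ F `|` G `<=` S.
      by split; [rewrite finite_setU | rewrite subUset].
    exists (index _ FG) => H /= FGH.
    by split; [apply: FA | apply: GB] => p ?; apply: FGH; [left | right].
  - by move=> A B AB [F FA]; exists F => G /FA /AB.
have [U [UU aboveU]] := ultraFilterLemma pr.
have [y yE] := ultrapower_realized UU bk bgen a (fun j F => x F j).
exists y => p Sp; apply: yE; apply: aboveU.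
have onep : finite_set [set p] /\ [set p] `<=` S by split=> // _ ->.
by exists (index _ onep) => F /= pF; apply: xE; apply: pF.
Qed.

(** * Homomorphisms and syntax *)

Lemma homomorphism_of_basic (L : signature) (M N : structure L) (f : M -> N) :
  (forall g v, f (fun_interp (f := g) v) = fun_interp (f \o v)) ->
  (forall r v, rel_interp (r := r) v -> rel_interp (r := r) (f \o v)) ->
  homomorphism f.
Proof.
move=> ff fr.
have fe n (v : 'I_n -> M) (t : term L n) : f (eval v t) = eval (f \o v) t.
  by elim: t => //= g args IH; rewrite ff; congr fun_interp; apply: funext => i; exact: IH.
move=> n p; elim: p => {n} [n|n|n s t|n r args|n p IHp q IHq|n p IHp q IHq|n p IHp] v //=.
- by move=> st; rewrite -!fe st.
- move=> /fr; congr (rel_interp _); apply: funext => i; exact: fe.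
- by case=> /IHp ? /IHq.
- by case=> [/IHp|/IHq]; [left | right].
- case=> x /IHp px; exists (f x); congr (sat _ _): px; apply: funext => i.
  by rewrite /vcons /=; case: (unlift _ _).
Qed.

Lemma homomorphism_rel (L : signature) (M N : structure L) (f : M -> N) r v :
  homomorphism f -> rel_interp (r := r) v -> rel_interp (r := r) (f \o v).
Proof. by move=> homf; apply: (homf _ (FRel (fun i => Var L i)) v). Qed.

(** The graph of a function symbol is defined by an atomic formula. *)
Lemma homomorphism_fun (L : signature) (M N : structure L) (f : M -> N) g v :
  homomorphism f -> f (fun_interp (f := g) v) = fun_interp (f \o v).
Proof.
move=> homf.
have := homf _ (FEq (Var L ord0) (App (fun i => Var L (lift ord0 i))))
  (vcons (fun_interp (f := g) v) v).
rewrite /= /vcons unlift_none /= => -> //.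
  by congr fun_interp; apply: funext => i; rewrite /= liftK.
by congr fun_interp; apply: funext => i; rewrite /= liftK.
Qed.

Lemma homomorphism_comp (L : signature) (M N P : structure L) (f : M -> N) (g : N -> P) :
  homomorphism f -> homomorphism g -> homomorphism (g \o f).
Proof. by move=> homf homg n p v /homf /homg. Qed.

Definition pick2 (X : Type) (x y : X) : 'I_2 -> X :=
  fun i => if i == ord0 then x else y.

Lemma pick2_eta (X : Type) (v : 'I_2 -> X) : pick2 (v ord0) (v ord_max) = v.
Proof.
apply: funext => i; rewrite /pick2; case: eqP => [-> //|i0]; congr v.
by apply: val_inj; case: i i0 => -[|[|]] //= ? [] ; apply: val_inj.
Qed.

Section Syntax.
Variable K : fieldType.

Definition term_zero n : term (LK K) n :=
  @App (LK K) n (FZero K) (fun i : 'I_0 => match notF (valP i) with end).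
Definition term_add n (s t : term (LK K) n) : term (LK K) n :=
  @App (LK K) n (FAdd K) (pick2 s t).
Definition term_opp n (t : term (LK K) n) : term (LK K) n :=
  @App (LK K) n (FOpp K) (fun=> t).
Definition term_scale n (c : K) (t : term (LK K) n) : term (LK K) n :=
  @App (LK K) n (FScale c) (fun=> t).
Definition term_comb n (c : 'I_n -> K) : term (LK K) n :=
  foldr (fun i => term_add (term_scale (c i) (Var (LK K) i))) (term_zero n) (enum 'I_n).
Definition form_eq n (s t : term (LK K) n) (c : K) : formula (LK K) n :=
  @FRel (LK K) n (RForm c) (pick2 s t).
Definition conj_all n (X : Type) (F : X -> formula (LK K) n) (s : seq X) :
    formula (LK K) n :=
  foldr (fun x => FAnd (F x)) (FTop (LK K) n) s.

Lemma eval_comb (V : lmodType K) (b : {biscalar V}) n (c : 'I_n -> K) (v : 'I_n -> V) :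
  eval (M := bilinear_structure b) v (term_comb c) = \sum_i c i *: v i.
Proof.
rewrite -big_enum /term_comb; elim: (enum _) => [|i s IH] /=.
  by rewrite big_nil.
by rewrite big_cons IH.
Qed.

Lemma sat_form_eq (V : lmodType K) (b : {biscalar V}) n (s t : term (LK K) n) c v :
  sat (M := bilinear_structure b) (form_eq s t c) v =
  (b (eval (M := bilinear_structure b) v s)
     (eval (M := bilinear_structure b) v t) = c).
Proof. by []. Qed.

Lemma sat_conj_all (M : structure (LK K)) n (X : eqType) (F : X -> formula (LK K) n) s v :
  sat (M := M) (conj_all F s) v <-> forall x, x \in s -> sat (F x) v.
Proof.
elim: s => [|x s IH] /=; first by split.
split=> [[Fx /IH Fs] y|Fs].
  by rewrite inE => /orP[/eqP -> //|/Fs].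
by split; [apply: Fs; rewrite mem_head | apply/IH => y ys; apply: Fs; rewrite inE ys orbT].
Qed.

End Syntax.

(** * Models are vector spaces with a partial product *)

Lemma model_equation (K : fieldType) (k : form_kind) (M : structure (LK K)) n
    (s t : term (LK K) n) (v : 'I_n -> M) :
  is_model (kind_theory k) M ->
  (forall (V : lmodType K) (b : {biscalar V}) (u : 'I_n -> V),
     eval (M := bilinear_structure b) u s = eval (M := bilinear_structure b) u t) ->
  eval v s = eval v t.
Proof.
move=> modM st; apply: (modM (HSentence (FTop (LK K) n) (FEq s t)) _ v I).
by move=> V b _ u _; apply: st.
Qed.

(** The vector space axioms are equations, hence h-inductive sentences of the
    theory. *)
Lemma model_lmodType (K : fieldType) (k : form_kind) (M : structure (LK K)) :
  is_model (kind_theory k) M ->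
  exists (V : lmodType K) (h : M -> V) (g : V -> M),
    [/\ cancel h g, cancel g h &
        forall f v, h (fun_interp (f := f) v) = LK_fun_interp (h \o v)].
Proof.
move=> modM.
pose add (x y : M) : M := @fun_interp _ M (FAdd K) (pick2 x y).
pose scale (c : K) (x : M) : M := @fun_interp _ M (FScale c) (fun=> x).
pose opp (x : M) : M := @fun_interp _ M (FOpp K) (fun=> x).
pose zero : M := @fun_interp _ M (FZero K) (fun i : 'I_0 => match notF (valP i) with end).
pose X (i : 'I_3) := Var (LK K) i.
pose o0 : 'I_3 := Ordinal (isT : 0 < 3)%N.
pose o1 : 'I_3 := Ordinal (isT : 1 < 3)%N.
pose o2 : 'I_3 := Ordinal (isT : 2 < 3)%N.
pose v3 (x y z : M) (i : 'I_3) := match val i with 0%N => x | 1%N => y | _ => z end.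
have eval_add n (v : 'I_n -> M) s t : eval v (term_add s t) = add (eval v s) (eval v t).
  by rewrite /=; congr fun_interp; apply: funext => i; rewrite /pick2; case: ifP.
have eval_scale n (v : 'I_n -> M) c t : eval v (term_scale c t) = scale c (eval v t) by [].
have eval_zero n (v : 'I_n -> M) : eval v (term_zero K n) = zero.
  by rewrite /=; congr fun_interp; apply: funext => -[].
have eq3 (s t : term (LK K) 3) x y z := @model_equation K k M 3 s t (v3 x y z) modM.
have addA : associative add.
  move=> x y z; have := eq3 (term_add (X o0) (term_add (X o1) (X o2)))
    (term_add (term_add (X o0) (X o1)) (X o2)) x y z.
  by rewrite !eval_add; apply=> V b u; exact: addrA.
have addC : commutative add.
  move=> x y; have := eq3 (term_add (X o0) (X o1)) (term_add (X o1) (X o0)) x y zero.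
  by rewrite !eval_add; apply=> V b u; exact: addrC.
have add0 : left_id zero add.
  move=> x; have := eq3 (term_add (term_zero K 3) (X o0)) (X o0) x x x.
  by rewrite eval_add eval_zero; apply=> V b u; exact: add0r.
have addN : left_inverse zero opp add.
  move=> x; have := eq3 (term_add (term_opp (X o0)) (X o0)) (term_zero K 3) x x x.
  by rewrite eval_add eval_zero; apply=> V b u; exact: addNr.
pose C : choiceType := HB.pack (M : Type) (gen_eqMixin M) (gen_choiceMixin M).
pose zM := GRing.isZmodule.Build C addA addC add0 addN.
pose Z : zmodType := HB.pack (Choice.sort C) zM.
have scaleA c d (x : Z) : scale c (scale d x) = scale (c * d) x.
  have := eq3 (term_scale c (term_scale d (X o0))) (term_scale (c * d) (X o0)) x x x.
  by apply=> V b u; exact: scalerA.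
have scale1 : left_id 1 (scale : K -> Z -> Z).
  move=> x; have := eq3 (term_scale 1 (X o0)) (X o0) x x x.
  by apply=> V b u; exact: scale1r.
have scaleDr : right_distributive (scale : K -> Z -> Z) +%R.
  move=> c x y; have := eq3 (term_scale c (term_add (X o0) (X o1)))
    (term_add (term_scale c (X o0)) (term_scale c (X o1))) x y x.
  by rewrite eval_scale !eval_add; apply=> V b u; exact: scalerDr.
have scaleDl (x : Z) : {morph (scale^~ x : K -> Z) : c d / c + d}.
  move=> c d; have := eq3 (term_scale (c + d) (X o0))
    (term_add (term_scale c (X o0)) (term_scale d (X o0))) x x x.
  by rewrite eval_add; apply=> V b u; exact: scalerDl.
pose lM := GRing.Zmodule_isLmodule.Build K Z scaleA scale1 scaleDr scaleDl.
pose V : lmodType K := HB.pack (GRing.Zmodule.sort Z) lM.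
exists V, id, id; split=> // -[|||c] v /=.
- by rewrite -[RHS]/zero; congr fun_interp; apply: funext => -[].
- by rewrite -[RHS]/(add _ _) /add pick2_eta.
- by rewrite -[RHS]/(opp _); congr fun_interp; apply: funext => i; rewrite (ord1 i).
- by rewrite -[RHS]/(scale _ _); congr fun_interp; apply: funext => i; rewrite (ord1 i).
Qed.

Definition independent (K : fieldType) (V : lmodType K) n (e : 'I_n -> V) : Prop :=
  forall c : 'I_n -> K, \sum_i c i *: e i = 0 -> forall i, c i = 0.

Lemma independent_span (K : fieldType) (V : lmodType K) (w : seq V) :
  exists n (e : 'I_n -> V), independent e /\
    forall x, x \in w -> exists c : 'I_n -> K, x = \sum_i c i *: e i.
Proof.
elim: w => [|x w [n [e [free_e span_e]]]].
  by exists 0%N, (fun i : 'I_0 => match notF (valP i) with end); split=> // c _ [].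
have [[c xE]|xN] := pselect (exists c : 'I_n -> K, x = \sum_i c i *: e i).
  exists n, e; split=> // y; rewrite inE => /orP[/eqP ->|/span_e //].
  by exists c.
have sumE (c : 'I_n.+1 -> K) : \sum_i c i *: vcons x e i =
    c ord0 *: x + \sum_i c (lift ord0 i) *: e i.
  rewrite big_ord_recl /vcons unlift_none /=; congr (_ + _).
  by apply: eq_bigr => i _; rewrite liftK.
exists n.+1, (vcons x e); split=> [c|y].
  rewrite sumE => c0.
  have cx0 : c ord0 = 0.
    apply/eqP; apply: contraT => cN0; case: xN.
    exists (fun i => - (c ord0)^-1 * c (lift ord0 i)).
    under eq_bigr => i _ do rewrite -scalerA.
    rewrite -scaler_sumr scaleNr -scalerN.
    move/eqP: c0; rewrite addr_eq0 => /eqP <-.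
    by rewrite scalerA mulVf // scale1r.
  move: c0; rewrite cx0 scale0r add0r => /free_e c0 i.
  by case: (unliftP ord0 i) => [j|] ->.
rewrite inE => /orP[/eqP ->|/span_e[c ->]].
  exists (vcons 1 (fun=> 0)); rewrite sumE /vcons unlift_none scale1r big1 ?addr0 // => i _.
  by rewrite liftK scale0r.
exists (vcons 0 c); rewrite sumE /vcons unlift_none scale0r add0r.
by apply: eq_bigr => i _; rewrite liftK.
Qed.

Lemma dual_family (K : fieldType) (V : lmodType K) n (e : 'I_n -> V) :
  independent e ->
  exists phi : 'I_n -> {scalar V},
    forall (c : 'I_n -> K) i, phi i (\sum_j c j *: e j) = c i.
Proof.
move=> free_e.
have /choice[phi phiE] i : exists f : {scalar V},
    forall c : 'I_n -> K, f (\sum_j c j *: e j) = c i.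
  pose G := [set p : V * K^o |
    exists2 c : 'I_n -> K, p.1 = \sum_j c j *: e j & p.2 = c i].
  have [||f fE] := @linear_extension K V G;
    last by exists f => c; apply: fE; exists c.
  - split; first by exists (fun=> 0) => //; rewrite big1 // => j _; rewrite scale0r.
    move=> a [v l] [v' l'] [c /= -> ->] [c' /= -> ->].
    exists (fun j => a * c j + c' j) => //=.
    rewrite scaler_sumr -big_split; apply: eq_bigr => j _ /=.
    by rewrite scalerDl scalerA.
  - by move=> l [c /= /esym /free_e c0 ->].
by exists phi => c i; apply: phiE.
Qed.

Lemma eval_homomorphism (K : fieldType) (M : structure (LK K)) (V : lmodType K)
    (b : {biscalar V}) (h : M -> V) n (v : 'I_n -> M) (t : term (LK K) n) :
  (forall f u, h (fun_interp (f := f) u) = LK_fun_interp (h \o u)) ->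
  h (eval v t) = eval (M := bilinear_structure b) (h \o v) t.
Proof.
move=> hf; elim: t => //= f args IH; rewrite hf; congr LK_fun_interp.
by apply: funext => i; exact: IH.
Qed.

(** To fit a finite part of the partial product, express its vectors in a
    finite independent family [e].  If no form fitted, then no family of vectors
    in any space of kind [k], independent or not, could satisfy the same finite
    list of products: its form could be pulled back along the linear map sending
    [e] to this family.  So the theory would refute a pattern which holds in the
    model. *)
Lemma model_completion (K : fieldType) (k : form_kind) (M : structure (LK K)) :
  is_model (kind_theory k) M ->
  exists (V : lmodType K) (b : {biscalar V}) (h : M -> V) (g : V -> M),
    [/\ of_kind k b, cancel h g, cancel g h &
        homomorphism (h : M -> bilinear_structure b)].
Proof.
move=> modM; have [V [h [g [hK gK hf]]]] := model_lmodType modM.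
pose R := [set t : V * V * K | @rel_interp _ M (RForm t.2) (pick2 (g t.1.1) (g t.1.2))].
have [b0 b0E] : exists b : {biscalar V}, b = (fun _ _ => 0) :> (V -> V -> K).
  by apply: biscalar_of => *; rewrite mulr0 addr0.
have [s sR|b [bk bR]] := @form_extension K k V R.
  apply: contrapT => nofit.
  pose w := [seq t.1.1 | t <- s] ++ [seq t.1.2 | t <- s].
  have [n [e [free_e span_e]]] := independent_span w.
  have [phi phiE] := dual_family free_e.
  have coordE x : x \in w -> x = \sum_i phi i x *: e i.
    by move=> /span_e[c ->]; apply: eq_bigr => i _; rewrite phiE.
  have sw t : t \in s -> t.1.1 \in w /\ t.1.2 \in w.
    by move=> ts; split; rewrite mem_cat; apply/orP; [left | right]; apply/mapP; exists t.
  pose comb x : term (LK K) n := term_comb (fun i => phi i x).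
  pose fact (t : V * V * K) := form_eq (comb t.1.1) (comb t.1.2) t.2.
  (* no space of kind k contains the pattern, so the theory refutes it *)
  have inconsistent : kind_theory k (HSentence (conj_all fact s) (FBot (LK K) n)).
    move=> W b' b'k e' /= /sat_conj_all sat_s; apply: nofit.
    pose P x := \sum_i phi i x *: e' i.
    have PL a x y : P (a *: x + y) = a *: P x + P y.
      rewrite /P scaler_sumr -big_split; apply: eq_bigr => i _ /=.
      by rewrite linearP scalerDl scalerA.
    have [||b bE] := @biscalar_of K V (fun x y => b' (P x) (P y)).
    - by move=> a x y z; rewrite PL linearPl.
    - by move=> a x y z; rewrite PL linearPr.
    exists b; rewrite bE; split.
      rewrite /of_kind; case kE: k => //.
      + by move=> x y; exact: symmetric_kind kE b'k _ _.
      + by move=> x; exact: alternating_kind kE b'k _.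
    by move=> t /sat_s; rewrite sat_form_eq !eval_comb.
  apply: (modM _ inconsistent (g \o e)); apply/sat_conj_all => t ts.
  have combE x : x \in w -> eval (g \o e) (comb x) = g x.
    move=> xw; apply: (can_inj hK); rewrite gK (eval_homomorphism b0) //.
    rewrite eval_comb {2}(coordE _ xw); apply: eq_bigr => i _.
    by rewrite /= gK.
  have [tw1 tw2] := sw _ ts.
  have := sR _ ts; rewrite /R /= -(combE _ tw1) -(combE _ tw2).
  by congr rel_interp; apply: funext => i; rewrite /pick2; case: ifP.
exists V, b, h, g; split=> //; apply: homomorphism_of_basic => //.
move=> [|c] v.
  move=> vN hv; have e : v ord0 = v ord_max by exact: (can_inj hK).
  pose x i := Var (LK K) (i : 'I_2).
  have contra : kind_theory k (HSentence (FAnd (FEq (x ord0) (x ord_max))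
      (@FRel (LK K) 2 (RNeq K) x)) (FBot (LK K) 2)).
    by move=> W b' _ u /= [].
  by apply: (modM _ contra v); split.
by move=> vc; apply: bR; rewrite /R /= !hK pick2_eta.
Qed.

(** * Existentially closed spaces are the generic spaces *)

Lemma kind_space_model (K : fieldType) (k : form_kind) (V : lmodType K)
    (b : {biscalar V}) :
  of_kind k b -> is_model (kind_theory k) (bilinear_structure b).
Proof. by move=> bk s; apply. Qed.

(** The completion is an immersion which is the identity on vectors, so it adds
    no relation. *)
Lemma ec_model_space (K : fieldType) (k : form_kind) (M : structure (LK K)) :
  ec_model (kind_theory k) M ->
  exists (V : lmodType K) (b : {biscalar V}) (h : M -> V) (g : V -> M),
    [/\ of_kind k b, cancel h g, cancel g h,
        immersion (h : M -> bilinear_structure b) &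
        ec_model (kind_theory k) (bilinear_structure b)].
Proof.
move=> [modM ecM]; have [V [b [h [g [bk hK gK homh]]]]] := model_completion modM.
have immh := ecM (bilinear_structure b) h (kind_space_model bk) homh.
exists V, b, h, g; split=> //; split; first exact: kind_space_model.
move=> N f modN homf; split=> // n p v pfv.
have [_ refl] := ecM N (f \o h) modN (homomorphism_comp homh homf).
have hg : h \o (g \o v) = v by apply: funext => i; rewrite /= gK.
rewrite -hg; apply: homh; apply: refl.
by congr (sat _ _): pfv; rewrite -{1}hg.
Qed.

Lemma one_point_extension (K : fieldType) (k : form_kind) (V : lmodType K)
    (b : {biscalar V}) (phi psi : {scalar V}) (nu : K) :
  of_kind k b -> (forall x, transpose_values k (phi x) (psi x)) -> diagonal_value k nu ->
  exists b' : {biscalar (V * K^o)}, of_kind k b' /\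
    forall x (s : K) y (t : K), b' (x, s) (y, t) = b x y + t * phi x +
      s * psi y + s * t * nu.
Proof.
move=> bk phipsi nuk.
pose B (p q : V * K^o) : K :=
  b p.1 q.1 + q.2 * phi p.1 + p.2 * psi q.1 + p.2 * q.2 * nu.
have [||b' b'E] := @biscalar_of K _ B.
- move=> a [x s] [y t] [z u]; rewrite /B /= linearPl linearP /= -[a *: s]/(a * s).
  by ring.
- move=> a [x s] [y t] [z u]; rewrite /B /= linearPr linearP /= -[a *: s]/(a * s).
  by ring.
exists b'; rewrite b'E; split=> //.
move: bk phipsi nuk; rewrite /of_kind /transpose_values /diagonal_value.
case: k => //= bk phipsi nuk.
- move=> [x s] [y t]; rewrite /B /= bk !phipsi; ring.
- move=> [x s]; rewrite /B /= bk phipsi nuk; ring.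
Qed.

Lemma space_embedding (K : fieldType) (V W : lmodType K) (b : {biscalar V})
    (b' : {biscalar W}) (f : V -> W) :
  (forall a x y, f (a *: x + y) = a *: f x + f y) -> injective f ->
  (forall x y, b' (f x) (f y) = b x y) ->
  homomorphism (f : bilinear_structure b -> bilinear_structure b').
Proof.
move=> fL injf fb.
have f0 : f 0 = 0.
  by have := fL 1 0 0; rewrite !scale1r addr0 => /esym/eqP; rewrite -subr_eq0 addrK => /eqP.
have fZ a x : f (a *: x) = a *: f x by rewrite -[a *: x]addr0 fL f0 addr0.
apply: homomorphism_of_basic => [[|||c] v|[|c] v] /=; rewrite ?fb //.
- by rewrite -[v ord0]scale1r fL !scale1r.
- by rewrite -scaleN1r fZ scaleN1r.
- by move=> vN /injf.
Qed.

(** The formula describing [y] also mentions an auxiliary [z], orthogonal to the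
    generators of [D] on one side and with [y, z] = 1, which keeps [y] out of
    [D]. *)
Lemma ec_generic (K : fieldType) (k : form_kind) (V : lmodType K) (b : {biscalar V}) :
  of_kind k b -> ec_model (kind_theory k) (bilinear_structure b) -> generic_form k b.
Proof.
move=> bk [_ ecV] D phi psi nu [n [a aD]] phipsi nuk.
have [b1 [b1k b1E]] := one_point_extension bk phipsi nuk.
(* chi gives the products with z: 1 on y and 0 on V *)
have [chi chiE] : exists f : {scalar (V * K^o)%type},
    f = (fun p : V * K^o => p.2) :> (V * K^o -> K).
  by apply: scalar_of.
have [chi' chik] : exists f : {scalar (V * K^o)%type},
    forall x, transpose_values k (chi x) (f x).
  rewrite /transpose_values; case: (k); [by exists chi | by exists chi |].
  by exists (\- chi : {scalar (V * K^o)%type}).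
have nu0 : diagonal_value k (0 : K) by rewrite /diagonal_value; case: (k).
have [b2 [b2k b2E]] := one_point_extension b1k chik nu0.
pose i x : (V * K^o * K^o)%type := (x, 0, 0).
have homi : homomorphism (i : bilinear_structure b -> bilinear_structure b2).
  apply: space_embedding.
  - by move=> c x y; rewrite /i -[RHS]/(c *: x + y, c *: 0 + 0, c *: 0 + 0) scaler0 addr0.
  - by move=> x y [].
  - by move=> x y; rewrite b2E b1E !mul0r !addr0.
have [_ refl] := ecV _ _ (kind_space_model b2k) homi.
pose Y : term (LK K) n.+2 := Var (LK K) (lift ord0 ord0).
pose Z : term (LK K) n.+2 := Var (LK K) ord0.
pose A j : term (LK K) n.+2 := Var (LK K) (lift ord0 (lift ord0 j)).
pose p : formula (LK K) n := FEx (FEx (FAnd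
  (conj_all (fun j => FAnd (form_eq (A j) Y (phi (a j)))
     (FAnd (form_eq Y (A j) (psi (a j))) (form_eq (A j) Z 0))) (enum 'I_n))
  (FAnd (form_eq Y Y nu) (form_eq Y Z 1)))).
have satp (U : lmodType K) (c : {biscalar U}) (u : 'I_n -> U) :
    sat (M := bilinear_structure c) p u <->
    exists y z,
      [/\ forall j, [/\ c (u j) y = phi (a j), c y (u j) = psi (a j) & c (u j) z = 0],
      c y y = nu & c y z = 1].
  split=> [[y [z [/sat_conj_all sA]]]|[y [z [uyz yy yz]]]].
    rewrite /= /pick2 /= /vcons unlift_none !liftK /= unlift_none /= => -[yy yz].
    exists y, z; split=> // j; have := sA j; rewrite mem_enum => /(_ isT) /=.
    by rewrite /pick2 /= /vcons unlift_none !liftK /= unlift_none /= liftK /= => -[? []].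
  exists y, z; split; last first.
    by rewrite /= /pick2 /= /vcons unlift_none !liftK /= unlift_none.
  apply/sat_conj_all => j _; have [? ? ?] := uyz j.
  by rewrite /= /pick2 /= /vcons unlift_none !liftK /= unlift_none /= liftK /=.
have /refl : sat (M := bilinear_structure b2) p (i \o a).
  apply/satp; exists (0, 1, 0), (0, 0, 1).
  have [phi0 psi0] : phi 0 = 0 /\ psi 0 = 0 by rewrite !linear0.
  have [bx0 b0x] : (forall x, b x 0 = 0) /\ (forall x, b 0 x = 0).
    by split=> x; [exact: linear0r | exact: linear0l].
  have E2 x (s t : K) y (s' t' : K) : b2 (x, s, t) (y, s', t') =
      b x y + s' * phi x + s * psi y +
      s * s' * nu + t' * s + t * chi' (y, s').
    by rewrite b2E b1E chiE mulr0 addr0.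
  split=> [j||]; rewrite !E2 ?bx0 ?b0x ?phi0 ?psi0; first split; ring.
move=> /satp[y [z [ayz yy yz]]]; exists y; split=> //.
- move=> x /aD[c ->]; rewrite linear_sumlz linear_sum; apply: eq_bigr => j _.
  by rewrite linearZl_LR linearZ_LR; have [-> _ _] := ayz j.
- move=> x /aD[c ->]; rewrite linear_sumr linear_sum; apply: eq_bigr => j _.
  by rewrite linearZr_LR linearZ_LR; have [_ -> _] := ayz j.
- move=> /aD[c yE]; have := oner_neq0 K.
  rewrite -yz {1}yE linear_sumlz big1 ?eqxx // => j _.
  by rewrite linearZl_LR; have [_ _ ->] := ayz j; rewrite /= mulr0.
Qed.

(** A homomorphism into a model can be prolonged to a bilinear space; there its
    inverse, restricted to the span of the tuple under consideration, is a
    finite-dimensional partial isometry back to the generic space. *)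
Lemma generic_ec (K : fieldType) (k : form_kind) (V : lmodType K) (b : {biscalar V}) :
  of_kind k b -> generic_form k b -> ec_model (kind_theory k) (bilinear_structure b).
Proof.
move=> bk bgen; split; first exact: kind_space_model.
move=> N f0 modN homf0; split=> // n p v p_f0v.
have [W [b' [h [g [b'k _ _ homh]]]]] := model_completion modN.
pose f : V -> W := h \o f0.
pose Mb := bilinear_structure b; pose Mb' := bilinear_structure b'.
have homf : homomorphism (f : bilinear_structure b -> bilinear_structure b').
  exact: homomorphism_comp homf0 homh.
have fD x y : f (x + y) = f x + f y.
  by have := @homomorphism_fun (LK K) Mb Mb' f (FAdd K) (pick2 x y) homf.
have fZ c x : f (c *: x) = c *: f x.
  by have := @homomorphism_fun (LK K) Mb Mb' f (FScale c) (fun=> x) homf.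
have fb x y : b' (f x) (f y) = b x y.
  by have := @homomorphism_rel (LK K) Mb Mb' f (RForm (b x y)) (pick2 x y) homf erefl.
have fN x y : x <> y -> f x <> f y.
  move=> xy.
  by have := @homomorphism_rel (LK K) Mb Mb' f (RNeq K) (pick2 x y) homf xy.
have f0E : f 0 = 0 by rewrite -[X in f X](scale0r (0 : V)) fZ scale0r.
pose span_v := [set x | exists c : 'I_n -> K, x = \sum_i c i *: v i].
have sv : subspace span_v := subspace_combinations v.
pose Gamma := [set p : W * V | span_v p.2 /\ p.1 = f p.2].
apply: (@forced_sat K k W V b' b [set 0] b'k bgen _ _ _ (sat_forcing b')
  n p (f \o v) v Gamma).
- by move=> z w ->; rewrite linear0l.
- by move=> z w ->; rewrite linear0r.
- split.
  + split; first by split; [exact: subspace0 sv | rewrite /= f0E].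
    move=> c [w x] [w' x'] [/= sx ->] [/= sx' ->]; split; first exact: subspaceP.
    by rewrite /= fD fZ.
  + by move=> z ->; split; [exact: subspace0 sv | rewrite /= f0E].
  + move=> w x [/= _ ->]; split=> [fx|-> //].
    by apply: contrapT => /fN; rewrite f0E.
  + by move=> w x w' x' [/= _ ->] [/= _ ->].
- by exists n, v => _ [q [sq _] <-].
- by move=> i; split => //; exact: combinations_generator.
- exact: homh p_f0v.
Qed.

(** * Back and forth *)

Lemma partial_isometry_swap (K : fieldType) (V1 V2 : lmodType K) (b1 : {biscalar V1})
    (b2 : {biscalar V2}) (Gamma : set (V1 * V2)) :
  partial_isometry b1 b2 [set 0] Gamma ->
  partial_isometry b2 b1 [set 0] [set p | Gamma (p.2, p.1)].
Proof.
move=> [sG GZ GK Gb]; split.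
- split; first exact: (subspace0 sG).
  by move=> a [x y] [x' y'] /= Gxy Gxy'; exact: (subspaceP sG a Gxy Gxy').
- by move=> _ ->; exact: (subspace0 sG).
- by move=> y x /= /GK [? ?]; split.
- by move=> y x y' x' /= Gxy Gxy'; rewrite (Gb _ _ _ _ Gxy Gxy').
Qed.

Section BackAndForth.
Variables (K : fieldType) (k : form_kind) (V1 V2 : lmodType K).
Variables (b1 : {biscalar V1}) (b2 : {biscalar V2}).

Definition finite_isometry (Gamma : set (V1 * V2)) : Prop :=
  [/\ partial_isometry b1 b2 [set 0] Gamma, fin_span (fst @` Gamma) &
      fin_span (snd @` Gamma)].

Hypotheses (b1k : of_kind k b1) (b2k : of_kind k b2).
Hypotheses (gen1 : generic_form k b1) (gen2 : generic_form k b2).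

Lemma finite_isometry_forth (Gamma : set (V1 * V2)) x : finite_isometry Gamma ->
  exists2 Gamma', finite_isometry Gamma' & Gamma `<=` Gamma' /\ exists y, Gamma' (x, y).
Proof.
move=> [isoG fin1 fin2].
have [||y [G' [isoG' GG' G'xy G'fin]]] :=
  extend_partial_isometry b1k gen2 _ _ x isoG fin2.
- by move=> z w ->; rewrite linear0l.
- by move=> z w ->; rewrite linear0r.
exists G'; last by split=> //; exists y.
split=> //.
- apply: (fin_span_adjoin (v := x) fin1) => _ [p /G'fin[q Gq [c ->]] <-].
  by exists q.1; [exists q | exists c].
- apply: (fin_span_adjoin (v := y) fin2) => _ [p /G'fin[q Gq [c ->]] <-].
  by exists q.2; [exists q | exists c].
Qed.

End BackAndForth.

Lemma finite_isometry_swap (K : fieldType) (V1 V2 : lmodType K) (b1 : {biscalar V1})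
    (b2 : {biscalar V2}) (Gamma : set (V1 * V2)) :
  finite_isometry b1 b2 Gamma -> finite_isometry b2 b1 [set p | Gamma (p.2, p.1)].
Proof.
move=> [isoG fin1 fin2]; split; first exact: partial_isometry_swap.
- by apply: fin_span_sub fin2 _ => _ [[y x] /= Gxy <-]; exists (x, y).
- by apply: fin_span_sub fin1 _ => _ [[y x] /= Gxy <-]; exists (x, y).
Qed.

Lemma countable_enumeration (T : Type) (x0 : T) :
  countable [set: T] -> exists u : nat -> T, forall x, exists n, u n = x.
Proof.
move=> /countable_injP[f finj].
have /choice[u uE] n : exists x, (exists y, f y = n) -> f x = n.
  have [[y fy]|fN] := pselect (exists y, f y = n); first by exists y.
  by exists x0.
exists u => x; exists (f x); apply: finj; rewrite ?inE //; apply: uE; by exists x.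
Qed.

(** The union of a chain of finite-dimensional isometries, the n-th step of which
    puts the n-th vector of each side into the domain and the range. *)
Lemma back_and_forth (K : fieldType) (k : form_kind) (V1 V2 : lmodType K)
    (b1 : {biscalar V1}) (b2 : {biscalar V2}) :
  of_kind k b1 -> of_kind k b2 -> generic_form k b1 -> generic_form k b2 ->
  countable [set: V1] -> countable [set: V2] ->
  isomorphic (bilinear_structure b1) (bilinear_structure b2).
Proof.
move=> b1k b2k gen1 gen2 /(countable_enumeration 0)[u1 u1E].
move=> /(countable_enumeration 0)[u2 u2E].
pose state := {Gamma : set (V1 * V2) | finite_isometry b1 b2 Gamma}.
have /choice[step stepE] (s : state * V1 * V2) : exists s' : state,
    [/\ sval s.1.1 `<=` sval s', exists y, sval s' (s.1.2, y) & exists x, sval s' (x, s.2)].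
  case: s => -[[G isoG] x] y /=.
  have [G1 iso1 [GG1 [y' G1xy]]] := finite_isometry_forth b1k gen2 x isoG.
  have [G2 iso2 [G12 [x' G2yx]]] :=
    finite_isometry_forth b2k gen1 y (finite_isometry_swap iso1).
  exists (exist _ _ (finite_isometry_swap iso2)); split=> /=.
  - by move=> [a c] /GG1 Gac; apply: (G12 (c, a)).
  - by exists y'; apply: (G12 (y', x)).
  - by exists x'.
have iso0 : finite_isometry b1 b2 [set 0].
  split; last 2 first.
  - exists 0%N, (fun i : 'I_0 => match notF (valP i) with end) => _ [_ -> <-].
    by exists (fun=> 0); rewrite big_ord0.
  - exists 0%N, (fun i : 'I_0 => match notF (valP i) with end) => _ [_ -> <-].
    by exists (fun=> 0); rewrite big_ord0.
  split.
  - by split=> // a x y -> ->; rewrite scaler0 addr0.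
  - by move=> _ ->.
  - by move=> x y [-> ->].
  - by move=> x y x' y' [-> ->] [-> ->]; rewrite !linear0l.
pose chain := fix chain n : state :=
  if n is m.+1 then step (chain m, u1 m, u2 m) else exist _ _ iso0.
have chain_le m n : (m <= n)%N -> sval (chain m) `<=` sval (chain n).
  elim: n => [|n IH]; first by rewrite leqn0 => /eqP ->.
  rewrite leq_eqVlt => /orP[/eqP -> //|]; rewrite ltnS => /IH mn.
  by apply: subset_trans mn _; have [] := stepE (chain n, u1 n, u2 n).
pose G x y := exists n, sval (chain n) (x, y).
have common x y x' y' : G x y -> G x' y' -> exists Gamma,
    [/\ finite_isometry b1 b2 Gamma, Gamma (x, y), Gamma (x', y') &
        forall p, Gamma p -> G p.1 p.2].
  move=> [m mxy] [n nxy]; exists (sval (chain (maxn m n))); split.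
  - exact: (svalP (chain (maxn m n))).
  - by apply: chain_le mxy; rewrite leq_maxl.
  - by apply: chain_le nxy; rewrite leq_maxr.
  - by move=> [a c] Gac; exists (maxn m n).
have G_inj x y x' y' : G x y -> G x' y' -> (x = x' <-> y = y').
  move=> Gxy /(common _ _ _ _ Gxy)[Ga [[[sG _ GK _] _ _] Gxy' Gxy'' _]].
  have [xy yx] := GK _ _ (subspaceB sG Gxy' Gxy''); split=> e.
  - by apply/eqP; rewrite -subr_eq0; apply/eqP/xy; rewrite /= e subrr.
  - by apply/eqP; rewrite -subr_eq0; apply/eqP/yx; rewrite e subrr.
have GL a x y x' y' : G x y -> G x' y' -> G (a *: x + x') (a *: y + y').
  move=> Gxy /(common _ _ _ _ Gxy)[Ga [[[sG _ _ _] _ _] Gxy' Gxy'' GG]].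
  exact: (GG _ (subspaceP sG a Gxy' Gxy'')).
have Gb x y x' y' : G x y -> G x' y' -> b1 x x' = b2 y y'.
  by move=> Gxy /(common _ _ _ _ Gxy)[Ga [[[_ _ _ Gab] _ _] Gxy' Gxy'' _]]; exact: Gab.
have /choice[f fE] x : exists y, G x y.
  have [n <-] := u1E x; have [_ [y Gy] _] := stepE (chain n, u1 n, u2 n).
  by exists y, n.+1.
have /choice[g gE] y : exists x, G x y.
  have [n <-] := u2E y; have [_ _ [x Gx]] := stepE (chain n, u1 n, u2 n).
  by exists x, n.+1.
have fK : cancel f g by move=> x; apply/(G_inj _ _ _ _ (gE _) (fE _)).
have gK : cancel g f by move=> y; apply/(G_inj _ _ _ _ (fE _) (gE _)).
exists f, g; split=> //.
- apply: space_embedding; [|exact: can_inj fK|].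
  + by move=> a x y; apply/(G_inj _ _ _ _ (fE _) (GL a _ _ _ _ (fE x) (fE y))).
  + by move=> x y; rewrite (Gb _ _ _ _ (fE x) (fE y)).
- apply: space_embedding; [|exact: can_inj gK|].
  + by move=> a x y; apply/(G_inj _ _ _ _ (gE _) (GL a _ _ _ _ (gE x) (gE y))).
  + by move=> x y; rewrite (Gb _ _ _ _ (gE x) (gE y)).
Qed.

(** * A countable generic space *)

Lemma sum_coef_widen (K : fieldType) (f : nat -> K) (n : nat) (p : {poly K}) :
  (size p <= n)%N -> \sum_(i < size p) p`_i * f i = \sum_(i < n) p`_i * f i.
Proof.
move=> pn; rewrite (big_ord_widen n (fun i => p`_i * f i) pn) big_mkcond /=.
apply: eq_bigr => i _; case: ltnP => // /(nth_default 0) ->; by rewrite mul0r.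
Qed.

Lemma poly_form (K : fieldType) (beta : nat -> nat -> K) :
  exists b : {biscalar {poly K}}, forall i j, b 'X^i 'X^j = beta i j.
Proof.
pose L (f : nat -> K) (p : {poly K}) := \sum_(i < size p) p`_i * f i.
have LP f a p q : L f (a *: p + q) = a * L f p + L f q.
  pose n := maxn (size (a *: p + q)) (maxn (size p) (size q)).
  rewrite /L !(@sum_coef_widen K f n) ?leq_max ?leqnn ?orbT //.
  rewrite mulr_sumr -big_split; apply: eq_bigr => i _ /=.
  by rewrite coefD coefZ mulrDl mulrA.
have LX f i : L f 'X^i = f i.
  rewrite /L size_polyXn big_ord_recr /= coefXn eqxx mul1r big1 ?add0r // => j _.
  by rewrite coefXn ltn_eqF ?mul0r.
have [||b bE] := @biscalar_of K {poly K} (fun p q => L (fun i => L (beta i) q) p).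
- by move=> *; rewrite LP.
- move=> a p q r; rewrite /L mulr_sumr -big_split; apply: eq_bigr => i _ /=.
  by rewrite -!/(L _ _) LP mulrDr mulrCA.
by exists b => i j; rewrite bE !LX.
Qed.

Lemma poly_monomials (K : fieldType) n (p : {poly K}) :
  (size p <= n)%N -> p = \sum_(i < n) p`_i *: 'X^i.
Proof.
move=> pn; rewrite -{1}[p]coefK poly_def (big_ord_widen n (fun i => p`_i *: 'X^i) pn).
rewrite big_mkcond /=; apply: eq_bigr => i _.
by case: ltnP => // /(nth_default 0) ->; rewrite scale0r.
Qed.

Lemma poly_form_kind (K : fieldType) (k : form_kind) (b : {biscalar {poly K}}) :
  (forall i j, (i < j)%N -> transpose_values k (b 'X^i 'X^j) (b 'X^j 'X^i)) ->
  (forall i, diagonal_value k (b 'X^i 'X^i)) -> of_kind k b.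
Proof.
rewrite /transpose_values /diagonal_value /of_kind; case: k => // off diag.
- have sym i j : b 'X^i 'X^j = b 'X^j 'X^i.
    by case: (ltngtP i j) => [/off ->|/off ->|->].
  have symX i q : b 'X^i q = b q 'X^i.
    rewrite (poly_monomials (leqnn (size q))) linear_sumr linear_sumlz.
    by apply: eq_bigr => j _; rewrite linearZl_LR linearZr_LR sym.
  move=> p q; rewrite (poly_monomials (leqnn (size p))) linear_sumr linear_sumlz.
  by apply: eq_bigr => j _; rewrite linearZl_LR linearZr_LR symX.
- move=> p; rewrite (poly_monomials (leqnn (size p))).
  elim: (size p) => [|n IH]; first by rewrite big_ord0 linear0l.
  rewrite big_ord_recr /=; set S := \sum_(i < n) _ in IH *.
  have SX : b 'X^n S = - b S 'X^n.
    rewrite /S linear_sumr linear_sumlz -sumrN; apply: eq_bigr => i _.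
    by rewrite linearZl_LR linearZr_LR (off i n) //= mulrN.
  rewrite linearDl !linearDr IH !linearZl_LR !linearZr_LR SX diag /=.
  by rewrite mulrN !mulr0 addr0 add0r addrN.
Qed.

(** The data is coded in the 2-adic valuation of the index, the odd part of
    which leaves room for arbitrarily large indices. *)
Lemma repetitive_enumeration (K : eqType) : countable [set: K] ->
  exists d : nat -> option (seq K * seq K * K),
    forall t n, exists2 N, (n <= N)%N & d N = Some t.
Proof.
move=> /countable_injP[f finj].
pose e (t : seq K * seq K * K) : nat := pickle (map f t.1.1, map f t.1.2, f t.2).
have e_inj : injective e.
  have fI : injective f by move=> x y; apply: finj; rewrite inE.
  move=> [[s1 s2] c] [[s1' s2'] c'] /(pcan_inj pickleK)[].
  by move=> /(inj_map fI) -> /(inj_map fI) -> /fI ->.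
have /choice[d dE] m : exists o, forall t, e t = m -> o = Some t.
  have [[t et]|tN] := pselect (exists t, e t = m); last first.
    by exists None => t et; case: tN; exists t.
  by exists (Some t) => t' et'; congr Some; apply: e_inj; rewrite et et'.
exists (fun N => d (logn 2 N)) => t n; exists (2 ^ e t * n.*2.+1)%N.
  rewrite (leq_trans (leq_addr n.+1 n)) // addnS addnn.
  by rewrite leq_pmull // expn_gt0.
apply: dE; rewrite lognM ?expn_gt0 // pfactorK // (@logn_coprime 2) ?addn0 //.
by rewrite coprime2n /= odd_double.
Qed.

Lemma countable_poly (K : fieldType) : countable [set: K] -> countable [set: {poly K}].
Proof.
move=> /countable_injP[f finj]; apply/countable_injP.
have fI : injective f by move=> x y; apply: finj; rewrite inE.
exists (fun p : {poly K} => pickle (map f p)) => p q _ _ /(pcan_inj pickleK).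
by move=> /(inj_map fI) /poly_inj.
Qed.

(** The entry N of the enumeration prescribes row and column N of the Gram matrix
    up to the diagonal.  Given functionals on the polynomials of size at most m,
    some N >= m prescribes their values on the monomials, and 'X^N is the required
    vector, outside the subspace because of its degree. *)
Lemma countable_generic (K : fieldType) (k : form_kind) : countable [set: K] ->
  exists b : {biscalar {poly K}}, of_kind k b /\ generic_form k b.
Proof.
move=> /repetitive_enumeration[d dE].
pose D N := odflt ([::], [::], 0) (d N).
pose beta i j : K :=
  if (i < j)%N then (D j).1.1`_i
  else if (j < i)%N then
    match k with
    | General => (D i).1.2`_j
    | Symmetric => (D i).1.1`_j
    | Alternating => - (D i).1.1`_j
    end
  else if k is Alternating then 0 else (D i).2.
have [b bX] := poly_form beta.
exists b; split.
  apply: poly_form_kind => [i j ij|i]; rewrite !bX /beta ?ltnn.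
    by rewrite ij ltnNge (ltnW ij) /transpose_values; case: (k).
  by rewrite /diagonal_value; case: (k).
move=> A phi psi nu [n [a aA]] phipsi nuk.
pose m := \max_(i < n) size (a i).
have Am x : A x -> (size x <= m)%N.
  move=> /aA[c ->]; apply: (leq_trans (size_sum _ _ _)); apply/bigmax_leqP => i _.
  by apply: leq_trans (size_scale_leq _ _) _; apply: leq_bigmax.
pose row (f : {scalar {poly K}}) := mkseq (fun i => f 'X^i) m.
have [N mN dN] := dE (row phi, row psi, nu) m.
have DN : D N = (row phi, row psi, nu) by rewrite /D dN.
have im (i : 'I_m) : (i < N)%N := leq_trans (ltn_ord i) mN.
exists 'X^N; split.
- move=> x /Am xm; rewrite (poly_monomials xm) linear_sumlz linear_sum.
  apply: eq_bigr => i _; rewrite linearZl_LR linearZ_LR; congr (_ * _).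
  by rewrite bX /beta im DN /= nth_mkseq.
- move=> x /Am xm; rewrite (poly_monomials xm) linear_sumr linear_sum.
  apply: eq_bigr => i _; rewrite linearZr_LR linearZ_LR; congr (_ * _).
  have iN : (N < i)%N = false by rewrite ltnNge (ltnW (im i)).
  rewrite bX /beta im iN DN /= !nth_mkseq //.
  by have := phipsi 'X^i; rewrite /transpose_values; case: (k).
- rewrite bX /beta ltnn DN /=; move: nuk; rewrite /diagonal_value; by case: (k).
- by move=> /Am; rewrite size_polyXn leqNgt ltnS mN.
Qed.

Theorem corollary5p9 (K : fieldType) (T : theory (LK K))
    (hT : [\/ T = TK K, T = TKs K | T = TKa K]) :
  (forall M : structure (LK K), ec_model T M -> omega_saturated M) /\
  (countable (@setT K) -> omega_categorical T).
Proof.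
have [k {hT} ->] : exists k, T = kind_theory k.
  case: hT => ->; [exists General | by exists Symmetric | by exists Alternating].
  by apply/seteqP; split=> s sT V b; [move=> _|]; apply: sT.
split=> [M ecM|cK].
  have [V [b [h [g [bk hK gK [homh refl] ecV]]]]] := ec_model_space ecM.
  move=> n m a S finsat.
  have hcat (x : 'I_n -> M) : h \o vcat x a = vcat (h \o x) (h \o a).
    by apply: funext => i; rewrite /vcat /=; case: (fintype.split i).
  have [F finF FS|y yS] := @generic_saturated K k V b bk (ec_generic bk ecV) n m (h \o a) S.
    have [x xF] := finsat F finF FS; exists (h \o x) => p /xF /homh.
    by rewrite hcat.
  exists (g \o y) => p /yS py; apply: refl; rewrite hcat.
  by congr (sat _ (vcat _ _)): py; apply: funext => i; rewrite /= gK.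
have [b [bk bgen]] := countable_generic k cK.
exists (bilinear_structure b); split.
  by split; [exact: generic_ec | exact: countable_poly].
move=> N [ecN cN].
have [V [b' [h [g [b'k hK gK [homh refl] ecV]]]]] := ec_model_space ecN.
have cV : countable [set: V].
  move/countable_injP: cN => [f finj]; apply/countable_injP; exists (f \o g).
  move=> x y _ _ /= e; apply: (can_inj gK); apply: finj => //; by rewrite inE.
have homg : homomorphism (g : bilinear_structure b' -> N).
  move=> n p v pv; apply: refl; congr (sat _ _): pv.
  by apply: funext => i; rewrite /= gK.
have [f [f' [homf homf' fK f'K]]] :=
  back_and_forth bk b'k bgen (ec_generic b'k ecV) (countable_poly cK) cV.
exists (g \o f), (f' \o h); split.
- exact: homomorphism_comp homf homg.
- exact: homomorphism_comp homh homf'.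
- by move=> x /=; rewrite gK fK.
- by move=> x /=; rewrite f'K hK.
Qed.
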